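(* Let $\Lambda\subset H^*$ and $\Lambda_H\subset\mathbb{M}_H$ be closed and convex, let $f\in H^*$ and $w\in H$. Let $(u,\lambda)\in H\times\Lambda$ satisfy $$a(u,v)+b(\lambda,v)=\langle f,v\rangle,\qquad b(\mu-\lambda,u)\le\langle\mu-\lambda,w\rangle\qquad\text{for all }(v,\mu)\in H\times\Lambda,$$ and let $(u_h,\lambda_H)\in\mathbb{V}_h\times\Lambda_H$ satisfy $$a(u_h,v_h)+b(\lambda_H,v_h)=\langle f,v_h\rangle,\qquad b(\mu_H-\lambda_H,u_h)\le\langle\mu_H-\lambda_H,w\rangle\qquad\text{for all }(v_h,\mu_H)\in\mathbb{V}_h\times\Lambda_H.$$ Let $r_h=f-(-\Delta)^su_h\in H^*$. Then $$\|u-u_h\|_H^2+\|\lambda-\lambda_H\|_{H^*}^2\lesssim\|r_h-\lambda_H\|_{H^*}^2+b(\lambda_H-\lambda,u-u_h).$$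
   Context: Let $0<s<1$ and let $\Omega\subset\mathbb{R}^n$ be a bounded Lipschitz domain with polygonal boundary. $H^s(\Omega)$ has norm $\|v\|_{L^2(\Omega)}+|v|_{H^s(\Omega)}$, $|v|^2_{H^s(\Omega)}=\iint_{\Omega\times\Omega}\frac{(v(x)-v(y))^2}{|x-y|^{n+2s}}\,dy\,dx$. $H$ is either $H^s_0(\Omega)$ (closure in $H^s(\Omega)$ of the $v\in C^\infty(\overline\Omega)$ vanishing on $\partial\Omega$) or, for $s\in(\frac12,1)$ and a codimension-one set $\widetilde\Gamma$, $H^s_{\widetilde\Gamma^C}(\Omega)$ (closure of the $v\in C^\infty(\overline\Omega)$ vanishing on $\partial\Omega\setminus\widetilde\Gamma$). $H^*$ is its dual, $\langle\cdot,\cdot\rangle$ the duality pairing (extending the $L^2$ inner product). Functions are extended by $0$ to $\mathbb{R}^n\setminus\overline\Omega$, and $$a(u,v)=\frac{c_{n,s}}2\iint_{(\Omega\times\mathbb{R}^n)\cup(\mathbb{R}^n\times\Omega)}\frac{(u(x)-u(y))(v(x)-v(y))}{|x-y|^{n+2s}}\,dy\,dx,\qquad c_{n,s}=\frac{2^{2s}s\,\Gamma(\frac{n+2s}2)}{\pi^{n/2}\Gamma(1-s)}.$$ Standing fact: $a$ is continuous and coercive on $H$: $a(u,v)\le C\|u\|_H\|v\|_H$, $a(u,u)\ge\alpha\|u\|_H^2$. $(-\Delta)^s:H\to H^*$ is given by $\langle(-\Delta)^su,v\rangle=a(u,v)$. The bilinear form $b$ on $H^*\times H$ is $b(\mu,v)=\langle\mu,v\rangle$.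 $\mathbb{V}_h\subset H$ is the space of continuous piecewise linear functions in $H$ on a shape-regular triangulation $\mathcal{T}_h$ of $\Omega$, and $\mathbb{M}_H\subset H^*$ is the space of piecewise constant functions on a triangulation $\mathcal{T}_H$, acting on $H$ through the $L^2$ pairing (for problems with constraints on $\widetilde\Gamma$, piecewise constants on $\widetilde\Gamma$ acting through the trace on $\widetilde\Gamma$). $X\lesssim Y$ means $X\le C'Y$ with $C'>0$ independent of the mesh sizes, the data and the solutions.
   Formalization: The bound is proved as C1‖r_h−λ_H‖² + C2 b(λ_H−λ,u−u_h) with two positive constants; with one common constant it is false, since b may be negative (e.g. Ω=(−L,L), L large, V_h={0}, Λ_H={0}, λ=f/2). For b≥0 it gives the stated inequality. *)

(* Defs.v *)
From HB Require Import structures.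
From mathcomp Require Import all_boot all_order all_algebra.
From mathcomp Require Import all_classical all_reals all_analysis.
Set Implicit Arguments.
Unset Strict Implicit.
Unset Printing Implicit Defensive.
Import Order.TTheory GRing.Theory Num.Theory.
Import numFieldNormedType.Exports.
Local Open Scope classical_set_scope.
Local Open Scope ring_scope.

(* R^n carries the sigma-algebra generated by the coordinates, that is, the
   Borel sigma-algebra. *)
Section measurable_rV.
Variables (R : realType) (n : nat).

Definition rV_coord (i : 'I_n) (x : 'rV[R]_n) : R := x ord0 i.

Let rV_measurable : set (set 'rV[R]_n) := g_sigma_preimage rV_coord.

Let rV_set0 : rV_measurable set0. Proof. exact: sigma_algebra0. Qed.

Let rV_setC A : rV_measurable A -> rV_measurable (~` A).
Proof. exact: sigma_algebraC. Qed.

Let rV_bigcup (F : (set 'rV[R]_n)^nat) :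
  (forall i, rV_measurable (F i)) -> rV_measurable (\bigcup_i F i).
Proof. exact: sigma_algebra_bigcup. Qed.

HB.instance Definition _ := @isMeasurable.Build default_measure_display
  'rV[R]_n rV_measurable rV_set0 rV_setC rV_bigcup.

Lemma measurable_rV_coord (i : 'I_n) : measurable_fun setT (rV_coord i).
Proof.
move=> _ Y mY; rewrite setTI; apply: sub_sigma_algebra => /=.
rewrite -bigcup_seq/=; exists i => /=; first by rewrite mem_index_enum.
by exists Y => //; rewrite setTI.
Qed.

End measurable_rV.

Lemma measurable_fun_rV (R : realType) n d (T : measurableType d)
    (f : T -> 'rV[R]_n) :
  (forall i, measurable_fun setT (rV_coord i \o f)) -> measurable_fun setT f.
Proof.
move=> mf _ A mA.
have : preimage_set_system setT f (g_sigma_preimage (@rV_coord R n))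
    (setT `&` f @^-1` A) by exists A.
rewrite -g_sigma_preimage_comp; move: (_ `&` _).
apply: smallest_sub; first exact: sigma_algebra_measurable.
case: n f mf {A mA} => [|m] f mf; first by rewrite big_ord0.
rewrite -bigcup_mkord_ord => B [k _ [Y mY <-]]; exact: mf.
Qed.


Section lebesgue_rV.
Variable R : realType.
Local Open Scope ereal_scope.

Definition rV_cons n (p : R * 'rV[R]_n) : 'rV[R]_n.+1 :=
  (row_mx p.1%:M p.2 : 'rV[R]_(1 + n)).

Lemma rV_cons0 n (p : R * 'rV[R]_n) : rV_cons p ord0 ord0 = p.1.
Proof.
have := row_mxEl (p.1%:M : 'rV[R]_1) p.2 ord0 ord0; rewrite [in RHS]mxE eqxx mulr1n => <-.
by congr (row_mx _ _ _ _); exact: val_inj.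
Qed.

Lemma rV_consS n (p : R * 'rV[R]_n) i : rV_cons p ord0 (lift ord0 i) = p.2 ord0 i.
Proof.
rewrite -(row_mxEr (p.1%:M : 'rV[R]_1) p.2 ord0 i).
by congr (row_mx _ _ _ _); exact: val_inj.
Qed.

Lemma measurable_rV_cons n : measurable_fun setT (@rV_cons n).
Proof.
apply: measurable_fun_rV => i; case: (unliftP ord0 i) => [j|] ->.
- rewrite (_ : _ \o _ = rV_coord j \o snd).
    exact: (measurableT_comp (measurable_rV_coord j)).
  by apply/funext => p /=; rewrite /rV_coord rV_consS.
- rewrite (_ : _ \o _ = fst)//.
  by apply/funext => p /=; rewrite /rV_coord rV_cons0.
Qed.

Definition rV_uncons n (x : 'rV[R]_n.+1) : R * 'rV[R]_n :=
  (x ord0 ord0, (\row_i x ord0 (lift ord0 i))%R).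

Lemma rV_consK n : cancel (@rV_cons n) (@rV_uncons n).
Proof.
case=> x t; rewrite /rV_uncons rV_cons0; congr pair.
by apply/rowP => i; rewrite mxE rV_consS.
Qed.

Lemma rV_unconsK n : cancel (@rV_uncons n) (@rV_cons n).
Proof.
move=> x; apply/rowP => i; case: (unliftP ord0 i) => [j|] ->.
- by rewrite rV_consS mxE.
- by rewrite rV_cons0.
Qed.

Lemma measurable_rV_uncons n : measurable_fun setT (@rV_uncons n).
Proof.
apply: measurable_fun_pair; first exact: measurable_rV_coord.
apply: measurable_fun_rV => i; rewrite (_ : _ \o _ = rV_coord (lift ord0 i)).
  exact: measurable_rV_coord.
by apply/funext => x; rewrite /= /rV_coord mxE.
Qed.

Section step.
Variables (n : nat) (m : {sigma_finite_measure set 'rV[R]_n -> \bar R}).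

Definition leb_step : set 'rV[R]_n.+1 -> \bar R :=
  pushforward (@lebesgue_measure R \x m) (@rV_cons n).

Let leb_step0 : leb_step set0 = 0.
Proof. by rewrite /leb_step /pushforward preimage_set0 measure0. Qed.

Let leb_step_ge0 A : 0 <= leb_step A.
Proof. by rewrite /leb_step /pushforward; exact: measure_ge0. Qed.

Let leb_step_additive : semi_sigma_additive leb_step.
Proof.
have mc A : measurable A -> measurable (@rV_cons n @^-1` A).
  by move=> mA; rewrite -[X in measurable X]setTI; exact: measurable_rV_cons.
move=> F mF tF mUF; rewrite /leb_step /pushforward preimage_bigcup.
apply: measure_semi_sigma_additive => [k||]; first exact: mc.
- by apply/trivIsetP => i j _ _ ij; rewrite -preimage_setI;
    move/trivIsetP : tF => /(_ _ _ _ _ ij) ->//; rewrite preimage_set0.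
- by rewrite -preimage_bigcup; exact: mc.
Qed.

HB.instance Definition _ := isMeasure.Build _ _ _ leb_step
  leb_step0 leb_step_ge0 leb_step_additive.

Let leb_step_sigma_finite : sigma_finite setT leb_step.
Proof.
have /sigma_finiteP[F [TF ndF Foo]] := sigma_finiteT (@lebesgue_measure R).
have /sigma_finiteP[G [TG ndG Goo]] := sigma_finiteT m.
exists (fun k => @rV_uncons n @^-1` (F k `*` G k)).
  rewrite -preimage_bigcup -(preimage_setT (@rV_uncons n)); congr (_ @^-1` _).
  rewrite -setXTT TF TG predeqE => -[x y]; split.
    move=> [/= [i _ Fix] [k _ Gky]]; exists (maxn i k) => //; split.
    - by move: x Fix; exact/subsetPset/ndF/leq_maxl.
    - by move: y Gky; exact/subsetPset/ndG/leq_maxr.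
  by move=> [i _ []/= ? ?]; split; exists i.
move=> k; have [mF Fk] := Foo k; have [mG Gk] := Goo k; split.
  rewrite -[X in measurable X]setTI; apply: measurable_rV_uncons => //.
  exact: measurableX.
rewrite /leb_step /pushforward (_ : _ @^-1` _ = F k `*` G k).
  by rewrite product_measure1E// lte_mul_pinfty// ge0_fin_numE.
by rewrite -comp_preimage (_ : _ \o _ = id) ?preimage_id//; apply/funext => p; exact: rV_consK.
Qed.

HB.instance Definition _ := Measure_isSigmaFinite.Build _ _ _ leb_step
  leb_step_sigma_finite.

End step.

Fixpoint leb_rV n : {sigma_finite_measure set 'rV[R]_n -> \bar R} :=
  match n with
  | 0 => \d_ (0%R : 'rV[R]_0)
  | n.+1 => leb_step (leb_rV n)
  end.


(* Together with sigma-finiteness this characterizes the Lebesgue measure. *)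
Lemma leb_rV_box n (a b : 'I_n -> R) : (forall i, a i <= b i)%R ->
  leb_rV n [set x | forall i, (a i < x ord0 i <= b i)%R] =
  (\prod_(i < n) (b i - a i))%:E.
Proof.
elim: n a b => [|n IH] a b ab /=.
  by rewrite big_ord0 diracE mem_set//= => -[].
rewrite /leb_step /pushforward big_ord_recl EFinM.
have mbox m (c d : 'I_m -> R) :
    measurable [set x : 'rV[R]_m | forall i, (c i < x ord0 i <= d i)%R].
  rewrite (_ : mkset _ = \bigcap_(i in [set: 'I_m])
      (@rV_coord R m i @^-1` `]c i, d i]%classic)).
    apply: fin_bigcap_measurable => // i _; rewrite -[X in measurable X]setTI.
    exact: measurable_rV_coord.
  by apply/seteqP; split => x /= h i *; have := h i; rewrite /= in_itv; apply.
transitivity ((@lebesgue_measure R \x leb_rV n) (`]a ord0, b ord0]%classic `*`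
    [set x : 'rV[R]_n | forall i : 'I_n,
      (a (lift ord0 i) < x ord0 i <= b (lift ord0 i))%R])).
  congr (_ _); apply/seteqP; split => [p /= h|p /= [h1 h2] i].
    split; first by have := h ord0; rewrite rV_cons0 in_itv.
    by move=> i; have := h (lift ord0 i); rewrite rV_consS.
  by case: (unliftP ord0 i) => [j|] ->; rewrite ?rV_consS ?rV_cons0.
rewrite [LHS]product_measure1E; [|exact: measurable_itv|exact: mbox].
congr (_ * _); last by apply: IH => i; exact: ab.
transitivity (@lebesgue_measure R `]a ord0, b ord0]%classic) => //.
rewrite lebesgue_measure_itv/= lte_fin EFinB.
have := ab ord0; rewrite le_eqVlt => /predU1P[->|->//].
by rewrite ltxx subee.
Qed.

End lebesgue_rV.

Section euclidean.
Variables (R : realType) (n : nat).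
Implicit Types (x y : 'rV[R]_n) (A Om : set 'rV[R]_n) (f : 'rV[R]_n -> R).

(* The library norm on row vectors is the sup norm. *)
Definition dot x y : R := \sum_(i < n) x ord0 i * y ord0 i.

Definition enorm x : R := Num.sqrt (dot x x).

Definition bdry Om : set 'rV[R]_n := closure Om `\` interior Om.

Fixpoint Ck (k : nat) f : Prop :=
  if k is k'.+1 then
    continuous f /\ forall i : 'I_n,
      (forall x, derivable f x (delta_mx ord0 i)) /\
      Ck k' (fun x => 'D_(delta_mx ord0 i) f x)
  else continuous f.

Definition smooth f : Prop := forall k, Ck k f.

(* Locally and after a rotation (nu is the vertical direction) Om is the strict
   epigraph of a Lipschitz function gam of the horizontal component. *)
Definition lipschitz_boundary Om : Prop :=
  forall x, bdry Om x ->
  exists (nu : 'rV[R]_n) (gam : 'rV[R]_n -> R) (L delta : R),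
    [/\ enorm nu = 1, 0 < delta,
        forall y z, `|gam y - gam z| <= L * enorm (y - z) &
        forall y, enorm (y - x) < delta ->
          (Om y <-> gam (y - dot y nu *: nu) < dot y nu)].

(* A k-simplex in R^n is given by the matrix p whose k+1 rows are its vertices. *)
Definition simplex k (p : 'M[R]_(k.+1, n)) : set 'rV[R]_n :=
  [set x | exists t : 'rV[R]_k.+1,
    [/\ forall i, 0 <= t ord0 i, \sum_i t ord0 i = 1 & x = t *m p]].

Definition edges k (p : 'M[R]_(k.+1, n)) : 'M[R]_(k, n) :=
  \matrix_(i < k) (row (lift ord0 i) p - row ord0 p).

Definition nondegenerate k (p : 'M[R]_(k.+1, n)) : bool := row_free (edges p).

(* The convex hull of the common vertices of p and q. *)
Definition common_face k (p q : 'M[R]_(k.+1, n)) : set 'rV[R]_n :=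
  [set x | exists t : 'rV[R]_k.+1,
    [/\ forall i, 0 <= t ord0 i, \sum_i t ord0 i = 1, x = t *m p &
        forall i, t ord0 i != 0 -> exists j, row i p = row j q]].

Definition triangulation k N (T : 'I_N -> 'M[R]_(k.+1, n)) A : Prop :=
  [/\ forall i, nondegenerate (T i),
      closure A = \bigcup_(i in [set: 'I_N]) simplex (T i) &
      forall i j, i != j -> simplex (T i) <> simplex (T j) /\
        simplex (T i) `&` simplex (T j) = common_face (T i) (T j)].

(* Each simplex contains a ball of radius at least its diameter over kappa. *)
Definition shape_regular k N (kappa : R) (T : 'I_N -> 'M[R]_(k.+1, n)) : Prop :=
  forall i, exists (c : 'rV[R]_n) (r : R),
    [/\ 0 < r, forall x, enorm (x - c) <= r -> simplex (T i) x &
        forall x y, simplex (T i) x -> simplex (T i) y ->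
          enorm (x - y) <= kappa * r].

Definition polygonal_boundary Om : Prop :=
  exists N (F : 'I_N -> 'M[R]_(n.-1.+1, n)),
    (forall i, nondegenerate (F i)) /\
    bdry Om = \bigcup_(i in [set: 'I_N]) simplex (F i).

Definition polygonal_lipschitz_domain Om : Prop :=
  [/\ open Om, connected Om, Om !=set0, bounded_set Om &
      lipschitz_boundary Om /\ polygonal_boundary Om].

(* A has d-dimensional Hausdorff measure zero (d > 0). *)
Definition hausdorff_null (d : R) A : Prop :=
  forall eps : R, 0 < eps -> exists (c : nat -> 'rV[R]_n) (r : nat -> R),
    [/\ forall k, 0 <= r k,
        A `<=` \bigcup_k [set x | enorm (x - c k) <= r k] &
        (\sum_(0 <= k <oo) (r k `^ d)%:E <= eps%:E)%E].

Definition codimension_one A : Prop :=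
  [/\ A !=set0,
      forall d : R, (n.-1)%:R < d -> hausdorff_null d A &
      forall d : R, 0 < d < (n.-1)%:R -> ~ hausdorff_null d A].

(* Surface integral over a k-simplex: Gram determinant times the integral of
   the pull-back to the reference simplex in R^k. *)
Definition chart k (p : 'M[R]_(k.+1, n)) (t : 'rV[R]_k) : 'rV[R]_n :=
  row ord0 p + t *m edges p.

Definition ref_simplex k : set 'rV[R]_k :=
  [set t | (forall i, 0 <= t ord0 i) /\ \sum_i t ord0 i <= 1].

Definition surf_int k (p : 'M[R]_(k.+1, n)) f : R :=
  Num.sqrt (\det (edges p *m (edges p)^T)) *
  \int[leb_rV R k]_(t in @ref_simplex k) f (chart p t).

Definition surf_L2 k (p : 'M[R]_(k.+1, n)) f : Prop :=
  measurable_fun setT (f \o chart p) /\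
  (leb_rV R k).-integrable (@ref_simplex k) (fun t => (f (chart p t) ^+ 2)%:E).

End euclidean.

Section fractional_sobolev.
Variables (R : realType) (n : nat) (s : R) (Om : set 'rV[R]_n).
Local Notation E := 'rV[R]_n.
Local Notation mu := (leb_rV R n).
Local Notation mu2 := (leb_rV R n \x leb_rV R n)%E.
Implicit Types (u v : E -> R) (H S : set (E -> R)).

Definition kernel u v (p : E * E) : R :=
  (u p.1 - u p.2) * (v p.1 - v p.2) / enorm (p.1 - p.2) `^ (n%:R + 2 * s).

(* A function on Om is represented by its extension by zero. *)
Definition Hs : set (E -> R) :=
  [set v : E -> R | [/\ measurable_fun setT v,
               forall x, ~ closure Om x -> v x = 0,
               mu.-integrable Om (fun x => (v x ^+ 2)%:E) &
               mu2.-integrable (Om `*` Om) (EFin \o kernel v v)]].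

Definition L2_norm v : R := Num.sqrt (\int[mu]_(x in Om) (v x ^+ 2)).

Definition Hs_seminorm v : R :=
  Num.sqrt (\int[mu2]_(p in Om `*` Om) kernel v v p).

Definition Hs_norm v : R := L2_norm v + Hs_seminorm v.

Definition smooth_upto_bdry : set (E -> R) :=
  [set v | (forall x, ~ closure Om x -> v x = 0) /\
           exists g, smooth g /\ {in closure Om, v =1 g}].

Definition Hs_closure S : set (E -> R) :=
  [set v | Hs v /\ forall eps : R, 0 < eps ->
    exists phi, [/\ S phi, Hs phi & Hs_norm (v \- phi) < eps]].

Definition Hs_vanishing (A : set E) : set (E -> R) :=
  Hs_closure [set v | smooth_upto_bdry v /\ forall x, A x -> v x = 0].

(* The two choices of the energy space H: H^s_0(Om), and for s > 1/2 the space
   with a homogeneous condition on the complement of Gam only. *)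
Definition energy_space (Gam : set E) H : Prop :=
  H = Hs_vanishing (bdry Om) \/
  [/\ 2^-1 < s, codimension_one Gam, Gam `<=` closure Om &
      H = Hs_vanishing (bdry Om `\` Gam)].

Definition Gamma_fun (x : R) : R :=
  \int[@lebesgue_measure R]_(t in `]0, +oo[) (t `^ (x - 1) * expR (- t)).

Definition c_ns : R :=
  2 `^ (2 * s) * s * Gamma_fun ((n%:R + 2 * s) / 2) /
  (pi `^ (n%:R / 2) * Gamma_fun (1 - s)).

Definition form_domain : set (E * E) := (Om `*` setT) `|` (setT `*` Om).

Definition frac_form u v : R :=
  c_ns / 2 * \int[mu2]_(p in form_domain) kernel u v p.

(* frac_form is a total operator: continuity includes that the double integral
   converges absolutely. *)
Definition form_continuous H : Prop :=
  exists C : R, forall u v, H u -> H v ->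
    mu2.-integrable form_domain (EFin \o kernel u v) /\
    frac_form u v <= C * Hs_norm u * Hs_norm v.

Definition form_coercive H : Prop :=
  exists2 alpha : R, 0 < alpha &
    forall u, H u -> alpha * Hs_norm u ^+ 2 <= frac_form u u.

Definition functional : Type := (E -> R) -> R.
Implicit Types (lam nu f : functional) (Lam : set functional).

(* Only the values on H of an element of the dual of H are relevant. *)
Definition dual H : set functional :=
  [set lam | (forall (c : R) u v, H u -> H v ->
                lam (fun x => c * u x + v x) = c * lam u + lam v) /\
             exists C : R, forall v, H v -> `|lam v| <= C * Hs_norm v].

Definition dual_norm H lam : R :=
  sup [set `|lam v| | v in [set v | H v /\ Hs_norm v <= 1]].

Definition dual_closed H Lam : Prop :=
  forall lam, dual H lam ->
    (forall eps : R, 0 < eps ->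
       exists2 nu, Lam nu & dual_norm H (lam \- nu) < eps) -> Lam lam.

Definition bform lam v : R := lam v.

Definition frac_lap u : functional := frac_form u.

Definition Vh H N (T : 'I_N -> 'M[R]_(n.+1, n)) : set (E -> R) :=
  [set v | [/\ H v, {within closure Om, continuous v} &
               forall i, exists (g : E) (c : R),
                 forall x, simplex (T i) x -> v x = dot g x + c]].

Definition volume_multipliers H N (T : 'I_N -> 'M[R]_(n.+1, n)) :
    set functional :=
  [set lam | dual H lam /\ exists c : 'I_N -> R, forall v, H v ->
     lam v = \int[mu]_(x in Om) ((\sum_i c i * \1_(simplex (T i)) x) * v x)].

(* t is the trace of v on the union of the simplices F i. *)
Definition is_trace k N (F : 'I_N -> 'M[R]_(k.+1, n)) v (t : E -> R) : Prop :=
  (forall i, surf_L2 (F i) t) /\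
  exists phi : nat -> E -> R,
    [/\ forall j, smooth_upto_bdry (phi j) /\ Hs (phi j),
        Hs_norm (v \- phi j) @[j --> \oo] --> (0 : R) &
        \sum_i surf_int (F i) (fun x => (t x - phi j x) ^+ 2)
          @[j --> \oo] --> (0 : R)].

Definition surface_multipliers H k N (F : 'I_N -> 'M[R]_(k.+1, n)) :
    set functional :=
  [set lam | dual H lam /\ exists c : 'I_N -> R, forall v, H v ->
     exists2 t, is_trace F v t & lam v = \sum_i c i * surf_int (F i) t].

Definition multiplier_space (Gam : set E) H (M : set functional) : Prop :=
  (exists N (T : 'I_N -> 'M[R]_(n.+1, n)),
     triangulation T Om /\ M = volume_multipliers H T) \/
  [/\ 2^-1 < s, codimension_one Gam, Gam `<=` closure Om &
      exists N (F : 'I_N -> 'M[R]_(n.-1.+1, n)),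
        triangulation F Gam /\ M = surface_multipliers H F].

Definition mixed_solution (V : set (E -> R)) Lam f w u lam : Prop :=
  [/\ V u, Lam lam,
      forall v, V v -> frac_form u v + bform lam v = f v &
      forall nu, Lam nu -> bform (nu \- lam) u <= (nu \- lam) w].

End fractional_sobolev.

(* Main.v *)
Require Import Defs.
From mathcomp Require Import all_boot all_order all_algebra.
From mathcomp Require Import all_classical all_reals all_analysis.
From mathcomp Require Import measurable_realfun.
From mathcomp Require Import ring lra.
Set Implicit Arguments.
Unset Strict Implicit.
Unset Printing Implicit Defensive.
Import Order.TTheory GRing.Theory Num.Theory.
Import numFieldNormedType.Exports.
Local Open Scope classical_set_scope.
Local Open Scope ring_scope.

(** Put e := u - uh and rho := (f - (-Delta)^s uh) - lamH.  Since uh lies in H,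
    the continuous equation can be subtracted from the definition of the residual
    for every test function v of H, which gives the error equation
      a(e, v) = rho(v) - (lam - lamH)(v).
    This holds on all of H, so the meshes leave no trace in the constants.

    Taking v := e, coercivity gives
      alpha |e|^2 <= |rho|_* |e| + (lamH - lam)(e),
    and Young's inequality (coercive_sq_le) absorbs |e|; the duality term is kept
    with its sign.  Taking v arbitrary and reading the equation as a formula for
    lam - lamH, continuity of a gives |lam - lamH|_* <= |rho|_* + K |e|.
    Squaring this and inserting the bound on |e| finishes the proof.

    What remains is to justify the functional analysis.  The space H is closed
    under linear combinations (energy_space_lincomb): the Gagliardo integrand
    and the square of a linear combination are dominated pointwise, and
    approximating smooth functions can be combined.  An element of the dual is
    bounded by its dual norm (dual_le_norm), and a is bilinear and bounded in
    absolute value on H (frac_form_lincomb, frac_form_bounded).  All integrals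
    are taken over sets built from Om, whose measurability for the coordinate
    sigma-algebra follows from open_measurable_rV. *)

(** * Measurability on row vectors *)

Section measurability.
Variables (R : realType) (n : nat).
Local Notation E := 'rV[R]_n.

Lemma measurable_ball_rV (x : E) (e : R) : measurable (ball x e).
Proof.
have [e0|e0] := leP e 0; first by rewrite le0_ball0// measurable0.
rewrite (_ : ball x e = \bigcap_(j in [set: 'I_n])
    (@rV_coord R n j @^-1` ball (x ord0 j) e)).
  apply: fin_bigcap_measurable => // j _; rewrite -[X in measurable X]setTI.
  by apply: measurable_rV_coord => //; exact: measurable_ball.
apply/seteqP; split => [y [_ h] j _|y h]; first exact: h.
by split=> // i j; rewrite (ord1 i); exact: h.
Qed.

(** Every open set is a countable union of balls of the maximum norm with
    rational centre and radius 1/(k+1), and these balls are boxes. *)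
Lemma open_measurable_rV (A : set E) : open A -> measurable A.
Proof.
move=> oA.
pose B (p : {ffun 'I_n -> rat} * nat) : set E :=
  ball (\row_j ratr (p.1 j) : E) p.2.+1%:R^-1.
rewrite (_ : A = \bigcup_p [set y | B p y /\ B p `<=` A]).
  apply: countable_bigcupT_measurable => // p.
  have [sA|nsA] := pselect (B p `<=` A).
    rewrite (_ : mkset _ = B p); first exact: measurable_ball_rV.
    by apply/seteqP; split => [y []|y yB].
  rewrite (_ : mkset _ = set0) ?measurable0//.
  by apply/seteqP; split => // y [_ /nsA].
apply/seteqP; split => [x Ax|x [p _ [xB]]]; last exact.
have /nbhs_ballP[e /= e0 xeA] : nbhs x A by apply: open_nbhs_nbhs.
have [k] : exists k : nat, 0 + k.+1%:R^-1 < e / 2 by apply: ltr_add_invr; rewrite divr_gt0.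
rewrite add0r => ke.
have k0 : 0 < (k.+1%:R^-1 : R) by rewrite invr_gt0.
have /choice[q qx] : forall j, exists q : rat,
    ratr q \in `](x ord0 j - k.+1%:R^-1), (x ord0 j + k.+1%:R^-1)[.
  by move=> j; apply: rat_in_itvoo; rewrite ltrD2l gtrN.
have Bx : B (finfun q, k) x.
  split=> // i j; rewrite (ord1 i) mxE ffunE /ball/= ltr_distl.
  by have := qx j; rewrite in_itv.
exists (finfun q, k) => //; split=> // y By; apply: xeA.
apply: (@le_ball _ _ _ (k.+1%:R^-1 + k.+1%:R^-1)); first by rewrite [leRHS]splitr lerD// ltW.
by apply: ball_triangle By; exact: ball_sym.
Qed.

Lemma measurable_enorm : measurable_fun setT (@enorm R n).
Proof.
apply: measurableT_comp.
  by apply: continuous_measurable_fun; exact: sqrt_continuous.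
apply: measurable_sum => i; apply: measurable_funM; exact: measurable_rV_coord.
Qed.

Lemma measurable_kernel (s : R) (u v : E -> R) :
  measurable_fun setT u -> measurable_fun setT v ->
  measurable_fun setT (Defs.kernel s u v).
Proof.
move=> mu mv; have mB (w : E -> R) : measurable_fun setT w ->
    measurable_fun setT (fun p : E * E => w p.1 - w p.2).
  by move=> mw; apply: measurable_funB; apply: measurableT_comp.
rewrite (_ : Defs.kernel s u v = fun p => (u p.1 - u p.2) * (v p.1 - v p.2) *
    enorm (p.1 - p.2) `^ (- (n%:R + 2 * s))); last first.
  by apply/funext => p; rewrite powRN.
apply: measurable_funM; first by apply: measurable_funM; exact: mB.
apply: (measurableT_comp (measurable_powR _)).
apply: (measurableT_comp measurable_enorm).
apply: measurable_fun_rV => i.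
have := mB _ (measurable_rV_coord i).
by apply: eq_measurable_fun => p _; rewrite /rV_coord/= !mxE.
Qed.

End measurability.

(** * Integrals of quadratic integrands *)

Section quadratic_integrals.
Context d (T : measurableType d) (R : realType).
Variables (m : {measure set T -> \bar R}) (D : set T).
Hypothesis mD : measurable D.

Lemma integrable_lincomb (c : R) (f g : T -> R) :
  m.-integrable D (EFin \o f) -> m.-integrable D (EFin \o g) ->
  m.-integrable D (EFin \o (fun x => c * f x + g x)).
Proof.
move=> fi gi; rewrite (_ : _ \o _ = (fun x => (c%:E * (EFin \o f) x)%E) \+ (EFin \o g))%E.
  by apply: integrableD => //; exact: integrableZl.
by apply/funext => x.
Qed.

Lemma Rintegral_lincomb (c : R) (f g : T -> R) :
  m.-integrable D (EFin \o f) -> m.-integrable D (EFin \o g) ->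
  \int[m]_(x in D) (c * f x + g x) =
  c * \int[m]_(x in D) f x + \int[m]_(x in D) g x.
Proof.
move=> fi gi; rewrite RintegralD//; first by rewrite RintegralZl.
exact: (integrableZl mD c fi).
Qed.

(** The sandwich also supplies the integrability of q, so that closedness of the
    Sobolev space and the estimate of its norm come from one computation. *)
Lemma le_integrable_sq (k1 k2 : R) (q q1 q2 : T -> R) :
  measurable_fun D q ->
  m.-integrable D (EFin \o q1) -> m.-integrable D (EFin \o q2) ->
  (forall x, D x -> 0 <= q x <= k1 * q1 x + k2 * q2 x) ->
  m.-integrable D (EFin \o q) /\
  \int[m]_(x in D) q x <=
    k1 * \int[m]_(x in D) q1 x + k2 * \int[m]_(x in D) q2 x.
Proof.
move=> mq i1 i2 qle.
have i2' := integrableZl mD k2 i2.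
have i := integrable_lincomb k1 i1 i2'.
have iq : m.-integrable D (EFin \o q).
  apply: le_integrable i => //; first exact/measurable_EFinP.
  move=> x Dx; have /andP[q0 qx] := qle _ Dx.
  by rewrite /= lee_fin !ger0_norm// (le_trans q0).
split => //; rewrite -(RintegralZl k2 mD i2) -Rintegral_lincomb//.
by apply: le_Rintegral => // x /qle /andP[].
Qed.

End quadratic_integrals.

(** * The energy space is a linear space *)

Definition lincomb_closed (R : realType) (n : nat) (S : set ('rV[R]_n -> R)) :=
  forall (c : R) u v, S u -> S v -> S (fun x => c * u x + v x).

(** Meant for a, b, r the integrals of f^2, g^2 and (c f + g)^2, where the
    hypothesis comes from (c f + g)^2 <= 2 c^2 f^2 + 2 g^2.  The factor 2 in the
    conclusion is harmless for arguments about closures and spares Minkowski's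
    inequality. *)
Lemma sqrt_quasi_triangle (R : realType) (c a b r : R) : 0 <= a -> 0 <= b ->
  r <= 2 * c ^+ 2 * a + 2 * b ->
  Num.sqrt r <= 2 * (`|c| * Num.sqrt a + Num.sqrt b).
Proof.
move=> a0 b0 rle.
have t0 : 0 <= 2 * (`|c| * Num.sqrt a + Num.sqrt b).
  by rewrite mulr_ge0// addr_ge0// ?mulr_ge0// sqrtr_ge0.
rewrite -(ger0_norm t0) -sqrtr_sqr; apply/ler_wsqrtr/(le_trans rle).
have := sqr_sqrtr a0; have := sqr_sqrtr b0; have := real_normK (num_real c).
have := sqrtr_ge0 a; have := sqrtr_ge0 b; have := normr_ge0 c.
set C := `|c|; set A := Num.sqrt a; set B := Num.sqrt b.
move=> C0 B0 A0 <- <- <-.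
have : 0 <= C * A * B by rewrite !mulr_ge0.
have : 0 <= (C * A) ^+ 2 by rewrite sqr_ge0.
have : 0 <= B ^+ 2 by rewrite sqr_ge0.
by nra.
Qed.

Section smooth.
Variables (R : realType) (n : nat).
Local Notation E := 'rV[R]_n.

Lemma Ck_lincomb k : lincomb_closed (@Ck R n k).
Proof.
have clc (c : R) (u v : E -> R) : continuous u -> continuous v ->
    continuous (fun x => c * u x + v x).
  move=> cu cv x.
  exact: (continuousD (continuousM (@cst_continuous _ _ c x) (cu x)) (cv x)).
elim: k => [|k IH] c u v /=; first exact: clc.
move=> [cu du] [cv dv]; split; first exact: clc.
move=> i; have [du1 du2] := du i; have [dv1 dv2] := dv i.
have uv : (fun x => c * u x + v x) = (c \*: u) + v by [].
have dcu x : derivable (c \*: u) x (delta_mx ord0 i).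
  by apply: derivableZ; exact: du1.
split; first by move=> x; rewrite uv; apply: derivableD.
rewrite (_ : (fun x => _) = fun x : E =>
    c * 'D_(delta_mx ord0 i) u x + 'D_(delta_mx ord0 i) v x).
  exact: IH.
by apply/funext => x; rewrite uv deriveD// deriveZ.
Qed.

Lemma smooth_upto_bdry_lincomb (Om : set E) :
  lincomb_closed (smooth_upto_bdry Om).
Proof.
move=> c u v [u0 [g [sg ug]]] [v0 [h [sh vh]]]; split.
  by move=> x nx; rewrite u0// v0// mulr0 addr0.
exists (fun x => c * g x + h x); split.
  by move=> k; exact: Ck_lincomb (sg k) (sh k).
by move=> x xOm; rewrite ug// vh.
Qed.

End smooth.

Section sobolev_space.
Variables (R : realType) (n : nat) (s : R) (Om : set 'rV[R]_n).
Hypothesis openOm : open Om.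
Local Notation E := 'rV[R]_n.
Local Notation Hs := (@Hs R n s Om).
Local Notation Hs_norm := (@Hs_norm R n s Om).

Let mOm : measurable Om. Proof. exact: open_measurable_rV. Qed.

Let mOm2 : measurable (Om `*` Om). Proof. exact: measurableX. Qed.

Lemma Hs_norm_ge0 v : 0 <= Hs_norm v.
Proof. by rewrite addr_ge0// sqrtr_ge0. Qed.

Lemma kernel_ge0 (v : E -> R) p : 0 <= Defs.kernel s v v p.
Proof. by rewrite divr_ge0 ?powR_ge0// -expr2 sqr_ge0. Qed.

Lemma kernel_lincomb c (w u v : E -> R) p :
  Defs.kernel s w (fun x => c * u x + v x) p =
  c * Defs.kernel s w u p + Defs.kernel s w v p.
Proof. by rewrite /Defs.kernel; ring. Qed.

Lemma kernel_sym (u v : E -> R) : Defs.kernel s u v = Defs.kernel s v u.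
Proof. by apply/funext => p; rewrite /Defs.kernel [_ * (v _ - _)]mulrC. Qed.

Lemma sq_lincomb_le (a b c : R) :
  (c * a + b) ^+ 2 <= 2 * c ^+ 2 * a ^+ 2 + 2 * b ^+ 2.
Proof. by have := sqr_ge0 (c * a - b); nra. Qed.

Lemma kernel_lincomb_le c (u v : E -> R) p :
  Defs.kernel s (fun x => c * u x + v x) (fun x => c * u x + v x) p <=
  2 * c ^+ 2 * Defs.kernel s u u p + 2 * Defs.kernel s v v p.
Proof.
rewrite /Defs.kernel !mulrA -mulrDl ler_wpM2r// ?invr_ge0 ?powR_ge0//.
by have := sq_lincomb_le (u p.1 - u p.2) (v p.1 - v p.2) c; nra.
Qed.

Lemma L2_sq_lincomb c u v : Hs u -> Hs v ->
  (leb_rV R n).-integrable Om (fun x => ((c * u x + v x) ^+ 2)%:E) /\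
  \int[leb_rV R n]_(x in Om) ((c * u x + v x) ^+ 2) <=
  2 * c ^+ 2 * \int[leb_rV R n]_(x in Om) (u x ^+ 2) +
  2 * \int[leb_rV R n]_(x in Om) (v x ^+ 2).
Proof.
move=> [mu _ iu _] [mv _ iv _]; apply: le_integrable_sq iu iv _ => //.
  apply: measurable_funTS; apply: measurable_funX; apply: measurable_funD => //.
  exact: measurable_funM.
by move=> x _; rewrite sqr_ge0 sq_lincomb_le.
Qed.

Lemma Hs_sq_lincomb c u v : Hs u -> Hs v ->
  let w := fun x => c * u x + v x in
  (leb_rV R n \x leb_rV R n)%E.-integrable (Om `*` Om)
    (EFin \o Defs.kernel s w w) /\
  \int[(leb_rV R n \x leb_rV R n)%E]_(p in Om `*` Om) Defs.kernel s w w p <=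
  2 * c ^+ 2 *
    \int[(leb_rV R n \x leb_rV R n)%E]_(p in Om `*` Om) Defs.kernel s u u p +
  2 * \int[(leb_rV R n \x leb_rV R n)%E]_(p in Om `*` Om) Defs.kernel s v v p.
Proof.
move=> [mu _ _ iu] [mv _ _ iv] w; apply: le_integrable_sq iu iv _ => //.
  apply: measurable_funTS; apply: measurable_kernel; apply: measurable_funD => //;
  exact: measurable_funM.
by move=> p _; rewrite kernel_ge0 kernel_lincomb_le.
Qed.

Lemma Hs_lincomb : lincomb_closed Hs.
Proof.
move=> c u v Hu Hv; have [mu u0 _ _] := Hu; have [mv v0 _ _] := Hv.
split.
- by apply: measurable_funD => //; exact: measurable_funM.
- by move=> x nx; rewrite u0// v0// mulr0 addr0.
- by have [] := L2_sq_lincomb c Hu Hv.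
- by have [] := Hs_sq_lincomb c Hu Hv.
Qed.

Lemma Hs_norm_lincomb_le c u v : Hs u -> Hs v ->
  Hs_norm (fun x => c * u x + v x) <= 2 * (`|c| * Hs_norm u + Hs_norm v).
Proof.
move=> Hu Hv.
have [_ /sqrt_quasi_triangle L] := L2_sq_lincomb c Hu Hv.
have [_ /sqrt_quasi_triangle K] := Hs_sq_lincomb c Hu Hv.
have {}L := L (Rintegral_ge0 _ (fun x _ => sqr_ge0 (u x)))
              (Rintegral_ge0 _ (fun x _ => sqr_ge0 (v x))).
have {}K := K (Rintegral_ge0 _ (fun p _ => kernel_ge0 u p))
              (Rintegral_ge0 _ (fun p _ => kernel_ge0 v p)).
rewrite [leLHS]/Defs.Hs_norm (le_trans (lerD L K))//.
by rewrite /Defs.Hs_norm /L2_norm /Hs_seminorm le_eqVlt; apply/orP; left; apply/eqP; ring.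
Qed.

Lemma Hs_normZ c u : Hs u -> Hs_norm (fun x => c * u x) = `|c| * Hs_norm u.
Proof.
move=> [_ _ iu ku]; rewrite /Defs.Hs_norm mulrDr /L2_norm /Hs_seminorm.
have e (x : R) : `|c| * Num.sqrt x = Num.sqrt (c ^+ 2 * x).
  by rewrite sqrtrM ?sqr_ge0// sqrtr_sqr.
rewrite !e -!RintegralZl//; congr (Num.sqrt _ + Num.sqrt _).
  by apply: eq_Rintegral => x _; rewrite exprMn.
by apply: eq_Rintegral => p _; rewrite /Defs.kernel; ring.
Qed.

(** The approximants of u and v are combined with the same coefficients, and the
    quasi-triangle inequality controls the error. *)
Lemma Hs_closure_lincomb (S : set (E -> R)) :
  lincomb_closed S -> lincomb_closed (Hs_closure s Om S).
Proof.
move=> SL c u v [Hu ua] [Hv va]; split; first exact: Hs_lincomb.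
move=> e e0.
have c1 : 0 < `|c| + 1 by rewrite ltr_wpDl.
(* c may vanish, hence the division by |c| + 1; the tolerances leave room for
   the factor 2 of the quasi-triangle inequality. *)
have [phi [Sphi Hphi phiu]] := ua (e / 4 / (`|c| + 1)) ltac:(rewrite !divr_gt0//).
have [psi [Spsi Hpsi psiv]] := va (e / 4) ltac:(rewrite divr_gt0//).
exists (fun x => c * phi x + psi x); split; [exact: SL|exact: Hs_lincomb|].
have sub f g : Hs f -> Hs g -> Hs (f \- g).
  move=> Hf Hg; rewrite (_ : f \- g = fun x => -1 * g x + f x).
    exact: Hs_lincomb.
  by apply/funext => x /=; ring.
rewrite (_ : _ \- _ = fun x => c * (u \- phi) x + (v \- psi) x); last first.
  by apply/funext => x /=; ring.
apply: le_lt_trans (Hs_norm_lincomb_le c (sub _ _ Hu Hphi) (sub _ _ Hv Hpsi)) _.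
have : `|c| * Hs_norm (u \- phi) <= e / 4.
  rewrite ltr_pdivlMr// in phiu; apply: le_trans (ltW phiu).
  by rewrite mulrC ler_wpM2l ?Hs_norm_ge0// lerDl.
by lra.
Qed.

Lemma Hs_vanishing_lincomb (A : set E) : lincomb_closed (Hs_vanishing s Om A).
Proof.
apply: Hs_closure_lincomb => c u v [su u0] [sv v0]; split.
  exact: smooth_upto_bdry_lincomb.
by move=> x Ax; rewrite u0// v0// mulr0 addr0.
Qed.

Lemma energy_space_lincomb Gam H : energy_space s Om Gam H -> lincomb_closed H.
Proof. by case=> [->|[_ _ _ ->]]; exact: Hs_vanishing_lincomb. Qed.

Lemma energy_space_sub Gam H : energy_space s Om Gam H -> H `<=` Hs.
Proof. by case=> [->|[_ _ _ ->]] v []. Qed.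

End sobolev_space.

(** * The dual norm and the bilinear form *)

Section dual_space.
Variables (R : realType) (n : nat) (s : R) (Om : set 'rV[R]_n).
Hypothesis openOm : open Om.
Local Notation E := 'rV[R]_n.
Local Notation Hs_norm := (@Hs_norm R n s Om).
Variable H : set (E -> R).
Hypothesis HL : lincomb_closed H.
Hypothesis HHs : H `<=` @Hs R n s Om.
Local Notation dual := (@Defs.dual R n s Om H).
Local Notation dual_norm := (@dual_norm R n s Om H).
Local Notation frac_form := (@frac_form R n s Om).

Lemma lincomb_closedB u v : H u -> H v -> H (u \- v).
Proof.
move=> Hu Hv; rewrite (_ : u \- v = fun x => -1 * v x + u x); first exact: HL.
by apply/funext => x /=; ring.
Qed.

Lemma lincomb_closed0 u : H u -> H (fun=> 0).
Proof.
move=> Hu; rewrite (_ : (fun=> 0) = u \- u); first exact: lincomb_closedB.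
by apply/funext => x /=; rewrite subrr.
Qed.

Lemma lincomb_closedZ (c : R) u : H u -> H (fun x => c * u x).
Proof.
move=> Hu; rewrite (_ : (fun=> _) = fun x => c * u x + 0).
  by apply: HL => //; exact: lincomb_closed0 Hu.
by apply/funext => x; rewrite addr0.
Qed.

Lemma dualZ lam (c : R) v : dual lam -> H v -> lam (fun x => c * v x) = c * lam v.
Proof.
move=> [lin _] Hv; have H0 := lincomb_closed0 Hv.
have z : lam (fun=> 0) = 0.
  have := lin (-1) _ _ H0 H0; rewrite (_ : (fun=> -1 * 0 + 0) = fun=> 0).
    by rewrite mulN1r addNr.
  by apply/funext => x; rewrite mulr0 addr0.
rewrite -[RHS]addr0 -z -lin//; congr lam.
by apply/funext => x; rewrite addr0.
Qed.

Lemma dualB lam nu : dual lam -> dual nu -> dual (lam \- nu).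
Proof.
move=> [ll [C lC]] [nl [D nD]]; split.
  by move=> c u v Hu Hv /=; rewrite ll// nl//; ring.
exists (C + D) => v Hv /=; rewrite mulrDl.
by apply: le_trans (ler_normB _ _) _; exact: lerD (lC v Hv) (nD v Hv).
Qed.

(** The bound by some constant that membership in the dual provides makes the
    supremum a genuine one and settles the functions of norm zero; all others
    are rescaled to norm one. *)
Lemma dual_le_norm lam v : dual lam -> H v ->
  `|lam v| <= dual_norm lam * Hs_norm v.
Proof.
move=> dl Hv; have [_ [C lC]] := dl.
have ub : has_ubound [set `|lam v| | v in [set v | H v /\ Hs_norm v <= 1]].
  exists `|C| => _ /= [w [Hw w1] <-]; apply: le_trans (lC _ Hw) _.
  apply: le_trans (ler_norm _) _; rewrite normrM.
  by rewrite (ger0_norm (Hs_norm_ge0 s Om w)) ler_piMr.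
have := Hs_norm_ge0 s Om v; rewrite le_eqVlt => /predU1P[v0|v0].
  by have := lC _ Hv; rewrite -v0 !mulr0.
rewrite -ler_pdivrMr//; apply: ub_le_sup => //.
exists (fun x => (Hs_norm v)^-1 * v x).
  split; first exact: lincomb_closedZ.
  rewrite Hs_normZ//; last exact: HHs.
  by rewrite gtr0_norm ?invr_gt0// mulVf ?gt_eqF.
by rewrite dualZ// normrM gtr0_norm ?invr_gt0// mulrC.
Qed.

Lemma dual_norm_le lam (K : R) : H !=set0 -> 0 <= K ->
  (forall v, H v -> `|lam v| <= K * Hs_norm v) -> dual_norm lam <= K.
Proof.
move=> [u Hu] K0 lK; apply: ge_sup.
  exists `|lam (fun x => 0 * u x)|, (fun x => 0 * u x) => //.
  split; first exact: lincomb_closedZ.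
  by rewrite Hs_normZ//; [rewrite normr0 mul0r|exact: HHs].
move=> _ [v [Hv v1] <-]; apply: le_trans (lK _ Hv) _.
by rewrite ler_piMr.
Qed.

Lemma dual_norm_ge0 lam : 0 <= dual_norm lam.
Proof.
rewrite /Defs.dual_norm; set A := (X in sup X).
have [[[x Ax] ub]|/sup_out->//] := pselect (has_sup A).
by apply: le_trans (ub_le_sup ub Ax); case: Ax => v _ <-.
Qed.

Lemma frac_form_sym u v : frac_form u v = frac_form v u.
Proof. by rewrite /Defs.frac_form kernel_sym. Qed.

Hypothesis aC : form_continuous s Om H.

Lemma measurable_form_domain : measurable (@form_domain R n Om).
Proof.
by apply: measurableU; apply: measurableX => //; exact: open_measurable_rV.
Qed.

Lemma frac_form_lincomb (c : R) w u v : H w -> H u -> H v ->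
  frac_form w (fun x => c * u x + v x) = c * frac_form w u + frac_form w v.
Proof.
move=> Hw Hu Hv; have [C aC'] := aC.
have [iu _] := aC' _ _ Hw Hu; have [iv _] := aC' _ _ Hw Hv.
rewrite /Defs.frac_form [in LHS](_ : Defs.kernel _ _ _ =
    fun p => c * Defs.kernel s w u p + Defs.kernel s w v p).
  by rewrite Rintegral_lincomb//; [ring|exact: measurable_form_domain].
by apply/funext => p; exact: kernel_lincomb.
Qed.

Lemma frac_formB u v w : H u -> H v -> H w ->
  frac_form (u \- v) w = frac_form u w - frac_form v w.
Proof.
move=> Hu Hv Hw; rewrite ![frac_form _ w]frac_form_sym.
rewrite (_ : u \- v = fun x => -1 * v x + u x).
  by rewrite frac_form_lincomb//; ring.
by apply/funext => x /=; ring.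
Qed.

(** Continuity is an upper bound of a(u, v) only; applying it to v and to -v
    gives the bound of the absolute value. *)
Lemma frac_form_bounded : exists2 K : R, 0 <= K &
  forall u v, H u -> H v -> `|frac_form u v| <= K * Hs_norm u * Hs_norm v.
Proof.
have [C aC'] := aC; exists `|C| => // u v Hu Hv.
have le w : H w -> frac_form u w <= `|C| * Hs_norm u * Hs_norm w.
  move=> Hw; have [_ /le_trans] := aC' _ _ Hu Hw; apply.
  by rewrite !ler_wpM2r ?Hs_norm_ge0// ler_norm.
have H0 := lincomb_closed0 Hv.
have HNv := HL (-1) Hv H0.
rewrite ler_norml le//= andbT lerNl.
have -> : - frac_form u v = frac_form u (fun x => -1 * v x).
  have := frac_form_lincomb (-1) Hu Hv H0.
  have := frac_form_lincomb (-1) Hu H0 H0.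
  rewrite (_ : (fun=> -1 * 0 + 0) = fun=> 0); last first.
    by apply/funext => x; rewrite mulr0 addr0.
  rewrite (_ : (fun=> -1 * _ + 0) = fun x => -1 * v x); last first.
    by apply/funext => x; rewrite addr0.
  lra.
apply: le_trans (le _ (lincomb_closedZ (-1) Hv)) _.
by rewrite Hs_normZ//; [rewrite normrN1 mul1r|exact: HHs].
Qed.

Lemma frac_lap_dual u : H u -> dual (frac_lap s Om u).
Proof.
move=> Hu; split; first by move=> c v w Hv Hw; exact: frac_form_lincomb.
have [K _ aK] := frac_form_bounded.
by exists (K * Hs_norm u) => v Hv; exact: aK.
Qed.

End dual_space.

(** Completing the square in alpha e^2 <= rho e + b absorbs e. *)
Lemma coercive_sq_le (R : realType) (alpha e rho b : R) : 0 < alpha ->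
  alpha * e ^+ 2 <= rho * e + b ->
  e ^+ 2 <= alpha^-1 ^+ 2 * rho ^+ 2 + 2 * alpha^-1 * b.
Proof.
move=> al0 le; have := sqr_ge0 (e - alpha^-1 * rho).
have ai : 0 < alpha^-1 by rewrite invr_gt0.
have : alpha^-1 * (alpha * e ^+ 2) <= alpha^-1 * (rho * e + b).
  by rewrite ler_wpM2l// ltW.
by rewrite mulKf ?gt_eqF//; nra.
Qed.

(** * The a posteriori estimate *)

Lemma multiplier_space_dual (R : realType) (n : nat) (s : R)
    (Om Gam : set 'rV[R]_n) (H : set ('rV[R]_n -> R)) (M : set (functional R n)) :
  multiplier_space s Om Gam H M -> M `<=` Defs.dual s Om H.
Proof. by case=> [[N [T [_ ->]]]|[_ _ _ [N [F [_ ->]]]]] lam []. Qed.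

(* The term b(lamH - lam, u - uh) on the right-hand side has no sign, so the two
   terms of the bound carry their own constants; where that term is nonnegative
   this is the estimate with the single constant max(C1, C2). *)
Theorem theorem5p20 (R : realType) (n : nat) (s : R) (Om Gam : set 'rV[R]_n)
    (H : set ('rV[R]_n -> R)) (kappa : R)
    (n_gt0 : (0 < n)%N) (s01 : 0 < s < 1)
    (domOm : polygonal_lipschitz_domain Om)
    (spaceH : energy_space s Om Gam H)
    (aC : form_continuous s Om H) (aE : form_coercive s Om H) :
  exists C1 C2 : R, [/\ 0 < C1, 0 < C2 &
    forall (N : nat) (Th : 'I_N -> 'M[R]_(n.+1, n)) (MH : set (functional R n))
      (Lam LamH : set (functional R n)) (f : functional R n)
      (w u uh : 'rV[R]_n -> R) (lam lamH : functional R n),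
      triangulation Th Om -> shape_regular kappa Th ->
      multiplier_space s Om Gam H MH ->
      Lam `<=` dual s Om H -> dual_closed s Om H Lam -> @convex_set R _ Lam ->
      LamH `<=` MH -> dual_closed s Om H LamH -> @convex_set R _ LamH ->
      dual s Om H f -> H w ->
      mixed_solution s Om H Lam f w u lam ->
      mixed_solution s Om (Vh Om H Th) LamH f w uh lamH ->
      let rh : functional R n := f \- frac_lap s Om uh in
      Hs_norm s Om (u \- uh) ^+ 2 + dual_norm s Om H (lam \- lamH) ^+ 2 <=
      C1 * dual_norm s Om H (rh \- lamH) ^+ 2 + C2 * bform (lamH \- lam) (u \- uh)].
Proof.
have [openOm _ _ _ _] := domOm.
have HL := energy_space_lincomb openOm spaceH.
have HHs := energy_space_sub spaceH.
have [alpha al0 aE'] := aE.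
have [K K0 aK] := frac_form_bounded openOm HL HHs aC.
exists (2 + (1 + 2 * K ^+ 2) * alpha^-1 ^+ 2), ((1 + 2 * K ^+ 2) * (2 * alpha^-1)).
have ai : 0 < alpha^-1 by rewrite invr_gt0.
have K1 : 0 < 1 + 2 * K ^+ 2 by rewrite ltr_wpDr// mulr_ge0// sqr_ge0.
split; [by rewrite ltr_wpDr// mulr_ge0 ?sqr_ge0// ltW|by rewrite !mulr_gt0|].
move=> N Th MH Lam LamH f w u uh lam lamH _ _ /multiplier_space_dual MHd
  Lamd _ _ LamHM _ _ fd _ [Hu /Lamd lamd eqn _] [[Huh _ _] /LamHM/MHd lamHd _ _].
cbv zeta; set e := u \- uh.
set rho : functional R n := (f \- frac_lap s Om uh) \- lamH.
have He : H e by exact: lincomb_closedB.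
have rhod : Defs.dual s Om H rho.
  apply: (dualB _ lamHd); apply: (dualB fd).
  exact: (frac_lap_dual openOm HL HHs aC Huh).
(* The error equation: the continuous equation holds for every v of H, and the
   discrete solution enters only through its residual. *)
have err v : H v -> frac_form s Om e v = rho v - (lam \- lamH) v.
  move=> Hv; rewrite (frac_formB openOm aC Hu Huh Hv) /rho /=.
  by rewrite /frac_lap; have := eqn _ Hv; rewrite /bform; lra.
have e2 : Hs_norm s Om e ^+ 2 <= alpha^-1 ^+ 2 * dual_norm s Om H rho ^+ 2 +
    2 * alpha^-1 * bform (lamH \- lam) e.
  apply: coercive_sq_le => //; apply: le_trans (aE' _ He) _.
  rewrite err//; apply: le_trans (lerD (ler_norm (rho e)) (lexx _)) _.
  apply: le_trans (lerD (dual_le_norm openOm HL HHs rhod He) (lexx _)) _.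
  by rewrite lerD2l /bform/=; lra.
have n0 := dual_norm_ge0 s Om H rho.
have N0 := Hs_norm_ge0 s Om e.
(* The error equation read as a formula for lam - lamH. *)
have dl : dual_norm s Om H (lam \- lamH) <=
    dual_norm s Om H rho + K * Hs_norm s Om e.
  apply: (dual_norm_le openOm HL HHs).
  - by exists u.
  - by rewrite addr_ge0// mulr_ge0.
  - move=> v Hv.
    have -> : (lam \- lamH) v = rho v - frac_form s Om e v by rewrite err//; ring.
    apply: le_trans (ler_normB _ _) _; rewrite mulrDl.
    by apply: lerD; [exact: (dual_le_norm openOm HL HHs)|exact: aK].
have dl2 : dual_norm s Om H (lam \- lamH) ^+ 2 <=
    2 * dual_norm s Om H rho ^+ 2 + 2 * K ^+ 2 * Hs_norm s Om e ^+ 2.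
  have l0 := dual_norm_ge0 s Om H (lam \- lamH).
  have : dual_norm s Om H (lam \- lamH) ^+ 2 <=
      (dual_norm s Om H rho + K * Hs_norm s Om e) ^+ 2.
    by rewrite ler_pXn2r ?nnegrE ?addr_ge0 ?mulr_ge0.
  have := sqr_ge0 (dual_norm s Om H rho - K * Hs_norm s Om e).
  by nra.
apply: le_trans (lerD (lexx _) dl2) _.
have := ler_wpM2l (ltW K1) e2.
by lra.
Qed.
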